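(* Consider a reduced constrained pairwise covering problem. Suppose that a subset of parameters $P$ (i) has a coherent partition of parameters $(P_0,P_1)$, and (ii) has an induced constraint graph $G[P]$ that is isomorphic to the complete bipartite graph $K_{m,n}$ with partitions (sides) $A$ and $B$, where $m:=|A|\geq 2$ and $n:=|B|\geq 2$. Then for any valid covering array with $N$ tests, $$N\geq \mathrm{CAN}(2,m,2)+\mathrm{CAN}(2,n,2)-2$$ and $$w_i\geq \mathrm{CAN}(2,n,2)\quad\forall X_i\in A\cap P_0,$$ $$w_i\geq \mathrm{CAN}(2,m,2)\quad\forall X_i\in B\cap P_0,$$ $$w_i\leq N-\mathrm{CAN}(2,n,2)\quad\forall X_i\in A\cap P_1,$$ $$w_i\leq N-\mathrm{CAN}(2,m,2)\quad\forall X_i\in B\cap P_1,$$ where $w_i$ is the number of ones in the column associated with parameter $X_i$.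
   Context: A constrained pairwise covering problem consists of binary parameters $X_1,\dots,X_k$ and a set of pairwise constraints, each of the form $(X_i,X_j)\neq(\alpha,\beta)$ with $i\neq j$ and $\alpha,\beta\in\{0,1\}$. An assignment $x\in\{0,1\}^k$ is feasible if it satisfies all constraints. A pairwise assignment $(X_i,X_j)=(\alpha,\beta)$ is forbidden if no feasible $x$ has $(x_i,x_j)=(\alpha,\beta)$, i.e., if the constraint $(X_i,X_j)\neq(\alpha,\beta)$ is explicitly given or implied by the other constraints; in either case it is counted as a pairwise constraint of the problem. The problem is reduced if (i) no parameter has a fixed value (explicitly or by implication), i.e., each $X_i$ takes both values among feasible assignments, and (ii) there is at most one pairwise constraint (explicit or implied) per pair of parameters. A valid covering array with $N$ tests is a matrix $\mathbf{M}\in\{0,1\}^{N\times k}$ (rows are tests, column $i$ gives the values of $X_i$) in which every row is feasible and, for every pair $i\neq j$ and every $(\alpha,\beta)\in\{0,1\}^2$ such that $(X_i,X_j)=(\alpha,\beta)$ is not forbidden, some row has value $\alpha$ in column $i$ and value $\beta$ in column $j$. For a subset $P$ of the parameters, the induced constraint graph $G[P]=(P,E)$ has vertex set $P$ and an edge between each pair of parameters of $P$ that has a pairwise constraint (explicit or implied). It has a coherent partition $(P_0,P_1)$ if $P$ is the disjoint union of $P_0$ and $P_1$ and, for every pairwise constraint $(X_i,X_j)\neq(\alpha,\beta)$ between parameters of $P$, we have $X_i\in P_\alpha$ and $X_j\in P_\beta$. $\mathrm{CAN}(2,k,2)$ is the minimum $N$ for which there is a matrix in $\{0,1\}^{N\times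 k}$ such that for every two distinct columns each of the four pairs in $\{0,1\}^2$ appears in at least one row. *)

(* Defs.v *)
From mathcomp Require Import all_boot matrix.

Set Implicit Arguments.
Unset Strict Implicit.
Unset Printing Implicit Defensive.

(* [((i, a), (j, b))] stands for the constraint (X_i, X_j) <> (a, b), with the
   values 0 and 1 encoded as [false] and [true]. *)
Definition pconstraint (k : nat) : Type :=
  (('I_k * bool) * ('I_k * bool))%type.

Record problem (k : nat) := Problem {
  constraints : {set pconstraint k};
  constraints_neq : forall c, c \in constraints -> c.1.1 != c.2.1
}.

Definition satisfies k (x : 'I_k -> bool) (c : pconstraint k) : bool :=
  (x c.1.1, x c.2.1) != (c.1.2, c.2.2).

Definition feasible k (p : problem k) (x : 'I_k -> bool) : bool :=
  [forall c in constraints p, satisfies x c].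

(* For i != j this is "explicit or implied": every explicit constraint makes
   the corresponding pairwise assignment forbidden. *)
Definition forbidden k (p : problem k) (i j : 'I_k) (a b : bool) : bool :=
  ~~ [exists x : {ffun 'I_k -> bool},
        feasible p x && ((x i, x j) == (a, b))].

Definition reduced k (p : problem k) : Prop :=
  (forall (i : 'I_k) (a : bool),
     exists x : {ffun 'I_k -> bool}, feasible p x /\ x i = a) /\
  (forall (i j : 'I_k) (a b a' b' : bool), i != j ->
     forbidden p i j a b -> forbidden p i j a' b' -> (a, b) = (a', b')).

Definition covers N k (M : 'M[bool]_(N, k)) (i j : 'I_k) (a b : bool) : bool :=
  [exists r : 'I_N, (M r i, M r j) == (a, b)].

Definition valid_covering_array k (p : problem k) N (M : 'M[bool]_(N, k)) :
  Prop :=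
  (forall r : 'I_N, feasible p (M r)) /\
  (forall (i j : 'I_k) (a b : bool), i != j ->
     ~~ forbidden p i j a b -> covers M i j a b).

Definition constraint_graph k (p : problem k) : rel 'I_k :=
  fun i j => (i != j) && [exists ab : bool * bool, forbidden p i j ab.1 ab.2].

Definition coherent_partition k (p : problem k) (P P0 P1 : {set 'I_k}) : Prop :=
  [/\ P0 :|: P1 = P, [disjoint P0 & P1] &
      forall (i j : 'I_k) (a b : bool),
        i \in P -> j \in P -> i != j -> forbidden p i j a b ->
        (i \in if a then P1 else P0) /\ (j \in if b then P1 else P0)].

Definition induced (T : finType) (e : rel T) (P : {set T}) :
  rel {x : T | x \in P} := fun u v => e (val u) (val v).

Definition graph_iso (S T : finType) (e : rel S) (e' : rel T) (f : S -> T) :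
  Prop :=
  bijective f /\ forall u v : S, e' (f u) (f v) = e u v.

Definition is_left (S T : Type) (u : S + T) : bool :=
  if u is inl _ then true else false.

Definition complete_bipartite (m n : nat) : rel ('I_m + 'I_n)%type :=
  fun u v => is_left u != is_left v.

Definition iso_complete_bipartite (T : finType) (e : rel T)
    (P A B : {set T}) (m n : nat) : Prop :=
  exists f : {x : T | x \in P} -> ('I_m + 'I_n)%type,
    [/\ graph_iso (induced e (P := P)) (@complete_bipartite m n) f,
        A = [set val u | u : {x : T | x \in P} & is_left (f u)] &
        B = [set val u | u : {x : T | x \in P} & ~~ is_left (f u)]].

Definition covering_array N k (M : 'M[bool]_(N, k)) : bool :=
  [forall i, forall j, (i != j) ==>
     [forall a, forall b, covers M i j a b]].

Lemma covering_array_exists k :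
  exists N, [exists M : 'M[bool]_(N, k), covering_array M].
Proof.
exists #|{ffun 'I_k -> bool}|; apply/existsP.
exists (\matrix_(r, i) (enum_val r : {ffun 'I_k -> bool}) i)%R.
apply/forallP=> i; apply/forallP=> j; apply/implyP=> neq_ij.
apply/forallP=> a; apply/forallP=> b; apply/existsP.
exists (enum_rank [ffun l => if l == i then a else b]).
by rewrite !mxE enum_rankK !ffunE eqxx [j == i]eq_sym (negPf neq_ij).
Qed.

(* CAN(2, k, 2) *)
Definition CAN2 (k : nat) : nat := ex_minn (covering_array_exists k).

Definition ones N k (M : 'M[bool]_(N, k)) (i : 'I_k) : nat :=
  #|[set r : 'I_N | M r i]|.

(* Main.v *)
Require Import Defs.
From mathcomp Require Import all_boot matrix.

(** Write [c i] for the side of the coherent partition that contains [i], and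
    call a parameter active in a test when it takes the value [c i].  Every
    edge of the constraint graph inside [P] carries the constraint that its two
    ends are not both active.  As the graph is complete bipartite, the tests
    fall into three kinds: those where some parameter of [A] is active, those
    where some parameter of [B] is active, and those where none is; no test is
    of the first two kinds at once.

    Two distinct parameters of [A] are not adjacent, so all four pairs of values
    occur for them, and three of these contain an active value.  Hence the tests
    of the first kind, together with one extra row that is inactive everywhere,
    form a covering array on [A] ([CAN2_active_rows]).  The same holds for [B],
    and adding the two inequalities gives the bound on [N].

    For the weights, fix [i] in [A] and keep only the tests where [i] is
    inactive.  They contain every test where some parameter of [B] is active.
    They also contain a test where all of [B] is inactive: take a second
    parameter [i'] of [A] and a test where [i] is inactive and [i'] active.  So
    these tests already form a covering array on [B], without an extra row
    ([CAN2_inactive_rows]).  Their number is [ones M i] if [i] lies in [P0] and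
    [N - ones M i] if [i] lies in [P1]. *)

Set Implicit Arguments.
Unset Strict Implicit.
Unset Printing Implicit Defensive.

Section CoveringFamily.

Variables (T C : finType) (g : T -> C -> bool).

Definition covers_all_pairs (S : {set T}) (Q : {set C}) : Prop :=
  forall i j a b, i \in Q -> j \in Q -> i != j ->
    exists2 r, r \in S & g r i = a /\ g r j = b.

(** Renumbering the rows and columns by [enum_val] turns the family into the
    kind of matrix over which [CAN2] takes its minimum. *)
Lemma CAN2_le_card S Q : covers_all_pairs S Q -> CAN2 #|Q| <= #|S|.
Proof.
move=> cov; rewrite /CAN2; case: ex_minnP => N _; apply; apply/existsP.
exists (\matrix_(r < #|S|, i < #|Q|) g (enum_val r) (enum_val i))%R.
apply/forallP=> i; apply/forallP=> j; apply/implyP=> neq_ij.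
apply/forallP=> a; apply/forallP=> b; apply/existsP.
have neq_v : enum_val i != enum_val j by rewrite (inj_eq enum_val_inj).
have [r rS [ra rb]] := cov _ _ a b (enum_valP i) (enum_valP j) neq_v.
by exists (enum_rank_in rS r); rewrite !mxE enum_rankK_in // ra rb.
Qed.

End CoveringFamily.

Section ActiveRows.

Variables (T C : finType) (g : T -> C -> bool) (c : C -> bool).

Definition active_rows (Q : {set C}) : {set T} :=
  [set r | [exists i in Q, g r i == c i]].

Lemma mem_active_rows (Q : {set C}) r i :
  i \in Q -> g r i = c i -> r \in active_rows Q.
Proof.
by move=> iQ gri; rewrite inE; apply/existsP; exists i; rewrite iQ gri eqxx.
Qed.

(** A row outside [active_rows Q] is the complement of [c] on all of [Q], so a
    single row with these values can stand for all such rows.  It is the row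
    indexed by [None] below. *)
Lemma CAN2_active_rows (Q : {set C}) :
  covers_all_pairs g setT Q -> CAN2 #|Q| <= #|active_rows Q|.+1.
Proof.
move=> cov.
pose g' (r : option T) i := if r is Some s then g s i else ~~ c i.
pose S := None |: [set Some r | r in active_rows Q].
have ->: #|active_rows Q|.+1 = #|S|.
  rewrite cardsU1 (card_imset _ (@Some_inj _)).
  by case: imsetP => // -[].
apply: (@CAN2_le_card _ _ g') => i j a b iQ jQ neq_ij.
have [r _ [ra rb]] := cov i j a b iQ jQ neq_ij.
have [rS|rS] := boolP (r \in active_rows Q).
  by exists (Some r) => //; rewrite !inE imset_f.
exists None; first by rewrite !inE.
have inact l : l \in Q -> ~~ c l = g r l.
  move=> lQ; have := @mem_active_rows Q r l lQ; rewrite (negPf rS).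
  by case: (g r l); case: (c l) => // /(_ erefl).
by rewrite /= !inact.
Qed.

(** The two blocks of columns are in conflict: a row cannot be active on both.
    This is what a complete bipartite constraint graph with a coherent
    partition imposes on feasible tests. *)
Definition exclusive (Q R : {set C}) : Prop :=
  forall r i j, i \in Q -> j \in R -> g r i = c i -> g r j <> c j.

Lemma exclusiveC Q R : exclusive Q R -> exclusive R Q.
Proof. by move=> ex r i j iR jQ gi gj; apply: (ex r j i). Qed.

Lemma exclusive_disjoint Q R :
  exclusive Q R -> [disjoint active_rows Q & active_rows R].
Proof.
move=> ex; rewrite -setI_eq0; apply/eqP/setP=> r; rewrite !inE.
apply/andP=> -[/existsP[i /andP[iQ /eqP gi]] /existsP[j /andP[jR /eqP gj]]].
exact: ex iQ jR gi gj.
Qed.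

(** Fixing [i] at its inactive value loses no pair of values on [R].  A pair
    with an active entry forces [i] to be inactive.  The remaining pair comes
    from a row where another column [i'] of [Q] is active, since that makes the
    whole of [R] inactive; this is where [1 < #|Q|] matters. *)
Lemma CAN2_inactive_rows (Q R : {set C}) i :
    covers_all_pairs g setT Q -> covers_all_pairs g setT R ->
    exclusive Q R -> 1 < #|Q| -> i \in Q ->
  CAN2 #|R| <= #|[set r | g r i != c i]|.
Proof.
move=> covQ covR ex Q_gt1 iQ.
apply: (@CAN2_le_card _ _ g) => j l a b jR lR neq_jl.
have [i' i'Q neq_i'] : exists2 i', i' \in Q & i != i'.
  have: 0 < #|Q :\ i| by move: Q_gt1; rewrite (cardsD1 i) iQ.
  by case/card_gt0P=> i'; rewrite !inE eq_sym => /andP[? ?]; exists i'.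
have [r _ [ra rb]] := covR j l a b jR lR neq_jl.
have [gri|gri] := eqVneq (g r i) (c i); last by exists r; rewrite ?inE.
(* [r] has [i] active, so its values on [R] are the inactive ones, which the
   row [s] takes as well. *)
have [s _ [si si']] := covQ i i' (~~ c i) (c i') iQ i'Q neq_i'.
have same q : q \in R -> g s q = g r q.
  move=> qR; move: (ex r i q iQ qR gri) (ex s i' q i'Q qR si').
  by case: (g r q); case: (g s q); case: (c q).
by exists s; rewrite ?inE ?si ?same //; case: (c i).
Qed.

End ActiveRows.

Section CompleteBipartite.

Variables (T : finType) (e : rel T) (P A B : {set T}) (m n : nat).
Hypothesis HK : iso_complete_bipartite e P A B m n.

Lemma iso_complete_bipartite_sub : A \subset P /\ B \subset P.
Proof.
by case: HK => f [_ -> ->]; split; apply/subsetP=> _ /imsetP[u _ ->];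
  apply: valP.
Qed.

Lemma iso_complete_bipartite_edge i j : i \in A -> j \in B -> e i j.
Proof.
case: HK => f [[_ iso] -> ->] /imsetP[u fu ->] /imsetP[v fv ->].
move: fu fv (iso u v); rewrite !inE /induced => fu /negPf fv <-.
by rewrite /complete_bipartite fu fv.
Qed.

Lemma iso_complete_bipartite_independent i j :
  (i \in A /\ j \in A) \/ (i \in B /\ j \in B) -> ~~ e i j.
Proof.
by case: HK => f [[_ iso] -> ->] [] [/imsetP[u fu ->] /imsetP[v fv ->]];
  move: fu fv (iso u v); rewrite !inE /induced => fu fv <-;
  rewrite /complete_bipartite ?fu ?fv ?(negPf fu) ?(negPf fv).
Qed.

End CompleteBipartite.

Lemma feasible_not_forbidden k (p : problem k) (x : 'I_k -> bool) i j :
  feasible p x -> ~~ forbidden p i j (x i) (x j).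
Proof.
move=> /forallP fx; rewrite negbK; apply/existsP; exists (finfun x).
rewrite !ffunE eqxx andbT; apply/forallP=> q.
by move: (fx q); rewrite /satisfies !ffunE.
Qed.

Lemma coherent_forbidden k (p : problem k) P P0 P1 i j a b :
  coherent_partition p P P0 P1 -> i \in P -> j \in P -> i != j ->
  forbidden p i j a b -> a = (i \in P1) /\ b = (j \in P1).
Proof.
move=> [_ dis coh] iP jP neq_ij /(coh _ _ _ _ iP jP neq_ij)[].
have side l d : l \in (if d then P1 else P0) -> d = (l \in P1).
  by case: d => [->|/(disjointFr dis) ->].
by move=> /side ? /side ?.
Qed.

Lemma nonadjacent_covered k (p : problem k) N (M : 'M[bool]_(N, k))
    (Q : {set 'I_k}) :
    valid_covering_array p M ->
    (forall i j, i \in Q -> j \in Q -> ~~ constraint_graph p i j) ->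
  covers_all_pairs M setT Q.
Proof.
move=> [_ cov] indep i j a b iQ jQ neq_ij.
have nforb : ~~ forbidden p i j a b.
  apply: contra (indep i j iQ jQ) => forb.
  by rewrite /constraint_graph neq_ij; apply/existsP; exists (a, b).
by have /existsP[r /eqP[ra rb]] := cov _ _ _ _ neq_ij nforb; exists r.
Qed.

Lemma adjacent_exclusive k (p : problem k) P P0 P1 (Q R : {set 'I_k})
    N (M : 'M[bool]_(N, k)) :
    coherent_partition p P P0 P1 -> Q \subset P -> R \subset P ->
    (forall i j, i \in Q -> j \in R -> constraint_graph p i j) ->
    (forall r, feasible p (M r)) ->
  exclusive M (fun i => i \in P1) Q R.
Proof.
move=> coh /subsetP QP /subsetP RP adj feas r i j iQ jR gi gj.
have /andP[neq_ij /existsP[[a b] /= forb]] := adj i j iQ jR.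
have [ea eb] := coherent_forbidden coh (QP i iQ) (RP j jR) neq_ij forb.
have := feasible_not_forbidden i j (feas r).
by rewrite gi gj -ea -eb forb.
Qed.

Lemma inactive_ones0 k N (M : 'M[bool]_(N, k)) (P0 P1 : {set 'I_k}) i :
  [disjoint P0 & P1] -> i \in P0 ->
  #|[set r | M r i != (i \in P1)]| = ones M i.
Proof.
move=> dis /(disjointFr dis) ->.
by apply: eq_card => r; rewrite !inE; case: (M r i).
Qed.

Lemma inactive_ones1 k N (M : 'M[bool]_(N, k)) (P1 : {set 'I_k}) i :
  i \in P1 -> #|[set r | M r i != (i \in P1)]| + ones M i = N.
Proof.
move=> ->; rewrite addnC -[RHS](card_ord N) -(cardsC [set r | M r i]).
by congr (_ + _); apply: eq_card => r; rewrite !inE; case: (M r i).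
Qed.

Theorem theorem2 (k : nat) (p : problem k) (P P0 P1 A B : {set 'I_k})
    (m n : nat)
    (Hred : reduced p)
    (Hcoh : coherent_partition p P P0 P1)
    (HK : iso_complete_bipartite (constraint_graph p) P A B m n)
    (Hm : m = #|A|) (Hn : n = #|B|) (Hm2 : 2 <= m) (Hn2 : 2 <= n)
    (N : nat) (M : 'M[bool]_(N, k)) (HM : valid_covering_array p M) :
  CAN2 m + CAN2 n - 2 <= N /\
  (forall i : 'I_k, i \in A :&: P0 -> CAN2 n <= ones M i) /\
  (forall i : 'I_k, i \in B :&: P0 -> CAN2 m <= ones M i) /\
  (forall i : 'I_k, i \in A :&: P1 -> ones M i <= N - CAN2 n) /\
  (forall i : 'I_k, i \in B :&: P1 -> ones M i <= N - CAN2 m).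
Proof.
have [AP BP] := iso_complete_bipartite_sub HK.
have covA : covers_all_pairs M setT A.
  apply: (nonadjacent_covered HM) => i j iA jA.
  by apply: (iso_complete_bipartite_independent HK); left.
have covB : covers_all_pairs M setT B.
  apply: (nonadjacent_covered HM) => i j iB jB.
  by apply: (iso_complete_bipartite_independent HK); right.
have exAB : exclusive M (fun i => i \in P1) A B.
  exact: adjacent_exclusive Hcoh AP BP (iso_complete_bipartite_edge HK) HM.1.
have dis : [disjoint P0 & P1] by case: Hcoh.
rewrite Hm in Hm2 *; rewrite Hn in Hn2 *.
have inactA i (iA : i \in A) := CAN2_inactive_rows covA covB exAB Hm2 iA.
have inactB i (iB : i \in B) :=
  CAN2_inactive_rows covB covA (exclusiveC exAB) Hn2 iB.
have le_sub x y z : x <= y -> y + z = N -> z <= N - x.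
  by move=> le_xy <-; rewrite -addnBAC // leq_addl.
split.
  have actA := CAN2_active_rows (fun i => i \in P1) covA.
  have actB := CAN2_active_rows (fun i => i \in P1) covB.
  rewrite leq_subLR (leq_trans (leq_add actA actB)) // addSn addnS -addn2 addnC.
  rewrite leq_add2l -cardsUI disjoint_setI0 ?(exclusive_disjoint exAB) //.
  by rewrite cards0 addn0 -[X in _ <= X]card_ord max_card.
split; last split; last split=> i /setIP[iQ iP].
- by move=> i /setIP[iA iP]; rewrite -(inactive_ones0 M dis iP) inactA.
- by move=> i /setIP[iB iP]; rewrite -(inactive_ones0 M dis iP) inactB.
- exact: le_sub (inactA i iQ) (inactive_ones1 M iP).
- exact: le_sub (inactB i iQ) (inactive_ones1 M iP).
Qed.
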